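(* For every integer $N$, the functions $$f_0(z)=q^{N}\frac{\phi_{N-1}(y,z)\,\phi_N(y/q,z)}{\phi_{N-1}(y/q,z)\,\phi_N(y,z)},\qquad f_1(z)=\frac{\phi_{N-1}(y/q,z/q)\,\phi_N(y,z)}{\phi_{N-1}(y,z)\,\phi_N(y/q,z/q)}$$ satisfy the $q$-difference Painlevé III equation $$f_1(qz)=\frac{c^2}{f_0(z)f_1(z)}\cdot\frac{1+z f_0(z)}{z+f_0(z)},\qquad f_0(z/q)=\frac{c^2}{f_0(z)f_1(z)}\cdot\frac{y/z+f_1(z)}{1+(y/z)f_1(z)}$$ with $c=q^N$ (here $y$ is a fixed parameter and $z$ the independent variable).
   Context: $q$ is a fixed nonzero complex constant that is not a root of unity; $y,z$ are variables. For $k\in\mathbb{Z}$ the polynomials $p_k(y,z)$ are defined by the generating function $\sum_{n\ge 0}p_n(y,z)t^n=\frac{(-(1-q)t;q)_\infty}{((1-q)yt;q)_\infty((1-q)zt;q)_\infty}$, with $(a;q)_\infty=\prod_{i\ge0}(1-aq^i)$, and $p_k=0$ for $k<0$; equivalently (via the $q$-binomial expansions) $p_n(y,z)=(1-q)^n\sum_{a+b+c=n}\frac{y^a z^b q^{c(c-1)/2}}{(q;q)_a(q;q)_b(q;q)_c}$ with $(q;q)_m=\prod_{j=1}^m(1-q^j)$. For $N>0$, $\phi_N(y,z)$ is the $N\times N$ determinant $\det\big(p_{N-2i+j+1}(y,z)\big)_{i,j=1}^N$ (first row $p_N,\dots,p_{2N-1}$, last row $p_{-N+2},\dots,p_1$);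 $\phi_0=1$; and for $N<0$, $\phi_N=(-1)^{N(N+1)/2}\phi_{-N-1}$. *)

(* Defs.v *)
From mathcomp Require Import all_boot all_algebra.
From mathcomp Require Import reals.
From mathcomp.real_closed Require Export complex.
Set Implicit Arguments. Unset Strict Implicit. Unset Printing Implicit Defensive.
Import GRing.Theory Num.Theory.
Local Open Scope ring_scope.

Section QPIII.
Variable R : realType.
Local Notation C := R[i].

Definition qpoch (q : C) (m : nat) : C := \prod_(j < m) (1 - q ^+ j.+1).

Definition p_nat (q : C) (n : nat) (y z : C) : C :=
  (1 - q) ^+ n *
  \sum_(a < n.+1) \sum_(b < n.+1 | (a + b <= n)%N)
     let c := (n - a - b)%N in
     y ^+ a * z ^+ b * q ^+ 'C(c, 2) / (qpoch q a * qpoch q b * qpoch q c).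

Definition p (q : C) (k : int) (y z : C) : C :=
  match k with
  | Posz n => p_nat q n y z
  | Negz _ => 0
  end.

Definition phi_nat (q : C) (N : nat) (y z : C) : C :=
  \det (\matrix_(i < N, j < N)
          p q (N%:Z - 2 * (i.+1)%:Z + (j.+1)%:Z + 1) y z).

(* phi_N for N : int; for N < 0, phi_N = (-1)^{N(N+1)/2} phi_{-N-1}.
   Negz n = -(n+1), so -N-1 = n and N(N+1)/2 = (n+1)n/2 = 'C(n+1,2). *)
Definition phi (q : C) (N : int) (y z : C) : C :=
  match N with
  | Posz n => phi_nat q n y z
  | Negz n => (-1) ^+ 'C(n.+1, 2) * phi_nat q n y z
  end.

Definition f0 (q : C) (N : int) (y z : C) : C :=
  q ^ N * (phi q (N - 1) y z * phi q N (y / q) z)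
        / (phi q (N - 1) (y / q) z * phi q N y z).

Definition f1 (q : C) (N : int) (y z : C) : C :=
  (phi q (N - 1) (y / q) (z / q) * phi q N y z)
  / (phi q (N - 1) y z * phi q N (y / q) (z / q)).

End QPIII.

(* Main.v *)
(**
  Let [tau N g] be the determinant [phi_N] with [p_k] replaced by [g k], and
  let [twist a] be multiplication of the generating series [sum_k g k t^k] by
  [1 - a t].  The three-term Pluecker relation for the rows [(a^j)_j],
  [(b^j)_j], [(1, 0, 0, ...)] and the first row of [tau] is a bilinear identity
  between [tau N] and [tau N.+1] at [g], [twist a g], [twist b g] and
  [twist a (twist b g)].  Indices drop by 2 from one row of [tau] to the next,
  so [tau] does not change when the series is multiplied by an even series with
  constant term 1; hence [twist (- a)] may be used as the inverse of [twist a].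
  Shifting [y] or [z] by [q] twists [p], and so does shifting both, up to the
  rescaling [t -> q t].  This produces four bilinear identities for [phi], which
  factor the numerators and denominators of the two right-hand sides.
*)
Require Import Defs.
From mathcomp Require Import all_boot all_fingroup all_algebra.
From mathcomp Require Import boolp reals.
From mathcomp.real_closed Require Import complex.
From mathcomp Require Import ring zify.
Import GRing.Theory Num.Theory.
Set Implicit Arguments. Unset Strict Implicit. Unset Printing Implicit Defensive.
Local Open Scope ring_scope.

(** * Unipotent column operations and row expansion *)

Lemma det_superdiag (F : fieldType) (n : nat) (a : F) :
  \det (\matrix_(i < n, j < n) ((i == j)%:R - a *+ (i.+1 == j))) = 1.
Proof.
rewrite -det_tr det_trig; last first.
  apply/is_trig_mxP => i j ltij; rewrite !mxE.
  have -> : (j == i) = false by apply/negbTE; rewrite -val_eqE /=; lia.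
  have -> : (j.+1 == i) = false by lia.
  by rewrite subr0.
by apply: big1 => i _; rewrite !mxE eqxx (gtn_eqF (ltnSn i)) subr0.
Qed.

(** All columns are reduced at once, each by the original preceding column: this is right
    multiplication by a unipotent bidiagonal matrix. *)
Lemma det_colop (F : fieldType) (n : nat) (a : F) (f : nat -> nat -> F) :
  \det (\matrix_(i < n, j < n) f i j) =
  \det (\matrix_(i < n, j < n)
          (f i j - (if j : nat is j'.+1 then a * f i j' else 0))).
Proof.
pose T : 'M[F]_n := \matrix_(k, j) ((k == j)%:R - a *+ (k.+1 == j)).
have detT : \det T = 1 := det_superdiag n a.
rewrite -[LHS]mulr1 -detT -det_mulmx; congr (\det _).
apply/matrixP => i j; rewrite !mxE.
under eq_bigr => k _ do rewrite !mxE mulrBr.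
rewrite sumrB (bigD1 j) //= eqxx mulr1 big1 ?addr0; last first.
  by move=> k /negbTE->; rewrite mulr0.
congr (_ - _); case: j => -[|j] ltj /=.
  by apply: big1 => k _; rewrite mulr0n mulr0.
rewrite (bigD1 (Ordinal (ltnW ltj))) //= eqxx mulr1n mulrC big1 ?addr0 //.
move=> k; rewrite -val_eqE /= eqSS => /negbTE->.
by rewrite mulr0n mulr0.
Qed.

Lemma det_row0 (F : fieldType) (n : nat) (f : nat -> nat -> F) :
  (forall j, f 0%N j.+1 = 0) ->
  \det (\matrix_(i < n.+1, j < n.+1) f i j) =
  f 0%N 0%N * \det (\matrix_(i < n, j < n) f i.+1 j.+1).
Proof.
move=> f0; rewrite (expand_det_row _ ord0) big_ord_recl !mxE big1 ?addr0.
  rewrite /cofactor /= addn0 expr0 mul1r; congr (_ * \det _).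
  by apply/matrixP => i j; rewrite !mxE /=.
by move=> j _; rewrite !mxE /= f0 mul0r.
Qed.

Lemma det_mx22 (F : fieldType) (A : 'M[F]_2) :
  \det A = A 0 0 * A 1 1 - A 0 1 * A 1 0.
Proof.
rewrite (expand_det_row _ 0) !big_ord_recl big_ord0 /cofactor !det_mx11 !mxE.
rewrite addr0 expr0 expr1 mul1r mulN1r mulrN.
by congr (_ * A _ _ - A _ _ * A _ _); apply/val_inj.
Qed.

(** * Bordered determinants and the three-term Pluecker relation *)

Definition bordered (F : fieldType) (n : nat) (u v : nat -> F)
    (r : nat -> nat -> F) : F :=
  \det (\matrix_(i < n.+2, j < n.+2)
          match i : nat with 0%N => u j | 1%N => v j | k.+2 => r k j end).

Lemma pluecker (F : fieldType) (n : nat) (r : nat -> nat -> F)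
    (u v w x : nat -> F) :
  bordered n u v r * bordered n w x r - bordered n u w r * bordered n v x r
  + bordered n u x r * bordered n v w r = 0.
Proof.
pose R : 'M[F]_(n, 2 + n) := \matrix_(i, j) r i j.
pose rv (s : nat -> F) : 'rV[F]_(2 + n) := \row_j s j.
have borderedE s t : bordered n s t r =
    \det (col_mx (\matrix_(i < 2, j < 2 + n) (if i == 0 then s j else t j)) R).
  congr (\det _); apply/matrixP => i j; rewrite [RHS]mxE /=.
  case: split_ordP => k ->; rewrite !mxE //=.
  by case: k => -[|[|]].
(* After column operations [R] vanishes on the first two columns, so each
   bordered determinant becomes a 2 x 2 determinant times a common factor. *)
pose s : 'S_(2 + n) := perm rev_ord_inj.
pose V := invmx (row_ebase R) *m perm_mx s.
have unitV : V \in unitmx by rewrite unitmx_mul unitmx_inv row_ebase_unit unitmx_perm.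
have [Q RV] : exists Q : 'M_n, R *m V = row_mx 0 Q.
  have -> : R *m V = col_ebase R *m (pid_mx (\rank R) *m perm_mx s).
    by rewrite -{1}(mulmx_ebase R) /V !mulmxA mulmxK // row_ebase_unit.
  exists (rsubmx (col_ebase R *m (pid_mx (\rank R) *m perm_mx s))).
  rewrite -[LHS]hsubmxK; congr row_mx.
  rewrite -[perm_mx s]hsubmxK !mul_mx_row row_mxKl.
  (* [pid_mx] has only [n] rows, so its last two columns vanish; [s] reverses the columns and brings
     these to the front. *)
  have -> : pid_mx (\rank R) *m lsubmx (perm_mx s) = 0 :> 'M[F]_(n, 2).
    apply/matrixP => i j; rewrite !mxE big1 // => k _; rewrite !mxE permE /=.
    have [/= /eqP eik|] := altP (i =P k :> nat); last by rewrite mul0r.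
    rewrite -val_eqE /=.
    have ltin := ltn_ord i; have ltj := ltn_ord j.
    have -> : ((2 + n - k.+1)%N == j) = false by move: eik => /eqP; lia.
    by rewrite mulr0.
  by rewrite mulmx0.
pose c (a : nat -> F) (k : 'I_2) := (rv a *m V) 0 (lshift n k).
have DV a b : bordered n a b r * \det V =
    (c a 0 * c b 1 - c a 1 * c b 0) * \det Q.
  rewrite borderedE -det_mulmx mul_col_mx RV.
  set M := _ *m V; rewrite -(hsubmxK M).
  rewrite (_ : col_mx _ _ = block_mx (lsubmx M) (rsubmx M) 0 Q) //.
  have lM i k : lsubmx M i k = if i == 0 then c a k else c b k.
    by rewrite /c !mxE; case: ifP => i0; apply: eq_bigr => j _; rewrite !mxE i0.
  by rewrite det_ublock det_mx22 !lM.
have V0 : \det V != 0 by rewrite -unitfE -unitmxE.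
apply: (mulIf (mulf_neq0 V0 V0)); rewrite mul0r.
transitivity (bordered n u v r * \det V * (bordered n w x r * \det V)
 - bordered n u w r * \det V * (bordered n v x r * \det V)
 + bordered n u x r * \det V * (bordered n v w r * \det V)); first ring.
by rewrite !DV; ring.
Qed.

(** * Bilinear identities for [tau] under twists *)

Definition tau (F : fieldType) (N : nat) (g : int -> F) : F :=
  \det (\matrix_(i < N, j < N) g (N%:Z - 2 * (i.+1)%:Z + (j.+1)%:Z + 1)).

Definition twist (F : fieldType) (a : F) (g : int -> F) (k : int) : F :=
  g k - a * g (k - 1).

(** Subtracting [a] times the preceding column turns the geometric row into [(1, 0, 0, ...)] and
    twists the others; deleting the first column then raises the indices by 1. *)
Lemma bordered_geo (F : fieldType) (n : nat) (a : F) (g : int -> F) :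
  bordered n (fun j => a ^+ j) (fun j => g (n%:Z + j%:Z))
    (fun k j => g (n%:Z - 2 * (k.+1)%:Z + j%:Z)) =
  tau n.+1 (twist a g).
Proof.
pose f i j := match i with 0%N => a ^+ j
  | 1%N => g (n%:Z + j%:Z) | k.+2 => g (n%:Z - 2 * (k.+1)%:Z + j%:Z) end.
pose f1 i j := f i j - (if j is j'.+1 then a * f i j' else 0).
transitivity (\det (\matrix_(i < n.+2, j < n.+2) f1 i j)).
  exact: (det_colop n.+2 a f).
rewrite (@det_row0 _ _ f1) => [|j]; last by rewrite /f1 /f exprS subrr.
rewrite /f1 /f subr0 mul1r; congr (\det _); apply/matrixP => i j.
rewrite !mxE /twist.
by case: i => -[|i] lti /=; congr (g _ - a * g _); lia.
Qed.

(** The first elimination turns the row [b ^+ j] into [(b - a) * b ^+ (j - 1)] for [j > 0], whence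
    the factor [b - a]; a second one, with ratio [b], clears that row. *)
Lemma bordered_geo2 (F : fieldType) (n : nat) (a b : F) (g : int -> F) :
  bordered n (fun j => a ^+ j) (fun j => b ^+ j)
    (fun k j => g (n%:Z - 2 * (k.+1)%:Z + j%:Z)) =
  (b - a) * tau n (twist b (twist a g)).
Proof.
pose f i j := match i with 0%N => a ^+ j
  | 1%N => b ^+ j | k.+2 => g (n%:Z - 2 * (k.+1)%:Z + j%:Z) end.
pose f1 i j := f i j - (if j is j'.+1 then a * f i j' else 0).
transitivity (\det (\matrix_(i < n.+2, j < n.+2) f1 i j)).
  exact: (det_colop n.+2 a f).
rewrite (@det_row0 _ _ f1) => [|j]; last by rewrite /f1 /f exprS subrr.
rewrite {1}/f1 /f subr0 mul1r (det_colop _ b (fun i j => f1 i.+1 j.+1)).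
pose f3 i j := f1 i.+1 j.+1 - (if j is j'.+1 then b * f1 i.+1 j'.+1 else 0).
rewrite -/(f3 _ _).
rewrite (@det_row0 _ _ f3) => [|j]; last by rewrite /f3 /f1 /f !exprS; ring.
rewrite {1}/f3 /f1 /f subr0 mulr1 expr1; congr (_ * \det _); apply/matrixP => i j.
by rewrite !mxE /twist; congr (g _ - a * g _ - b * (g _ - a * g _)); lia.
Qed.

Lemma tau_twist_exchange (F : fieldType) (n : nat) (a b : F) (g : int -> F) :
  (a - b) * (tau n (twist b (twist a g)) * tau n.+1 g) =
  a * (tau n (twist a g) * tau n.+1 (twist b g))
  - b * (tau n (twist b g) * tau n.+1 (twist a g)).
Proof.
have twist0 N h : tau N (twist 0 h) = tau N h :> F.
  congr (\det _); apply/matrixP => i j.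
  by rewrite !mxE /twist mul0r subr0.
(* As [0 ^+ 0 = 1], the row [0 ^+ j] is [(1, 0, 0, ...)]: a geometric row whose twist is trivial. *)
have := pluecker n (fun k j => g (n%:Z - 2 * (k.+1)%:Z + j%:Z))
  (fun j => a ^+ j) (fun j => b ^+ j) (fun j => 0 ^+ j) (fun j => g (n%:Z + j%:Z)).
rewrite !bordered_geo !bordered_geo2 !twist0 => H.
apply/eqP; rewrite -subr_eq0 -oppr_eq0 -H; apply/eqP; ring.
Qed.

(** The two twists multiply the series by [1 - a^2 t^2], which subtracts from each row [a ^+ 2]
    times the row below. *)
Lemma tau_even (F : fieldType) (N : nat) (a : F) (g : int -> F) :
  (forall n, g (Negz n) = 0) -> tau N (twist a (twist (- a) g)) = tau N g.
Proof.
move=> g0.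
pose T : 'M[F]_N := \matrix_(i, k) ((i == k)%:R - a ^+ 2 *+ (i.+1 == k)).
have detT : \det T = 1 := det_superdiag N (a ^+ 2).
rewrite -[RHS]mul1r -detT -det_mulmx; congr (\det _).
apply/matrixP => i j; rewrite !mxE.
under eq_bigr => k _ do rewrite !mxE mulrBl.
rewrite sumrB (bigD1 i) //= eqxx mul1r big1 ?addr0; last first.
  by move=> k; rewrite eq_sym => /negbTE->; rewrite mul0r.
set m := (_ + 1).
have -> : twist a (twist (- a) g) m = g m - a ^+ 2 * g (m - 2).
  by rewrite /twist (_ : m - 2 = m - 1 - 1); [ring | lia].
congr (_ - _).
have [ltiN|leNi] := ltnP i.+1 N.
  rewrite (bigD1 (Ordinal ltiN)) //= eqxx mulr1n big1 ?addr0; last first.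
    by move=> k; rewrite -val_eqE /= eq_sym => /negbTE->; rewrite mulr0n mul0r.
  by congr (_ * g _); rewrite /m; lia.
(* The last row has no row below, but there [m <= 1], so [g (m - 2)] vanishes. *)
rewrite big1 => [|k _]; last first.
  by rewrite (gtn_eqF (leq_trans (ltn_ord k) leNi)) mulr0n mul0r.
have : m - 2 < 0 by rewrite /m; have := ltn_ord j; lia.
by case: (m - 2) => // k _; rewrite g0 mulr0.
Qed.

Lemma twistC (F : fieldType) (a b : F) (g : int -> F) :
  twist a (twist b g) = twist b (twist a g).
Proof. by apply/funext => k; rewrite /twist; ring. Qed.

Lemma twist_neg (F : fieldType) (a : F) (g : int -> F) :
  (forall n, g (Negz n) = 0) -> forall n, twist a g (Negz n) = 0.
Proof.
move=> g0 n; rewrite /twist (_ : Negz n - 1 = Negz n.+1); last by lia.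
by rewrite !g0 mulr0 subr0.
Qed.

(** This is the exchange relation at [twist b g] with ratios [a] and [- b], where [twist (- b)]
    cancels [twist b] inside [tau]. *)
Lemma tau_twist_bilinear (F : fieldType) (n : nat) (a b : F) (g : int -> F) :
  (forall n, g (Negz n) = 0) ->
  a * (tau n (twist a (twist b g)) * tau n.+1 g)
  + b * (tau n g * tau n.+1 (twist a (twist b g))) =
  (a + b) * (tau n (twist a g) * tau n.+1 (twist b g)).
Proof.
move=> g0; have := tau_twist_exchange n a (- b) (twist b g).
rewrite (twistC (- b) a) (twistC (- b) b) (twistC a b (twist (- b) g)).
rewrite (twistC a (- b)) !tau_even //; last exact: twist_neg.
by rewrite opprK mulNr opprK => ->.
Qed.

(** The index is a row term plus a column term, so the powers of [q] factor out of rows and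
    columns. *)
Lemma tau_scale (F : fieldType) (N : nat) (q : F) (g : int -> F) : q != 0 ->
  tau N (fun k => q ^ k * g k) = (\prod_(i < N) q ^+ i.+1) * tau N g.
Proof.
move=> q0.
pose r : 'rV[F]_N := \row_i q ^ (N%:Z - 2 * (i.+1)%:Z + 1).
pose c : 'rV[F]_N := \row_i q ^ (i.+1)%:Z.
have -> : \prod_(i < N) q ^+ i.+1 = \det (diag_mx r) * \det (diag_mx c).
  (* Row [i] and column [i] together weigh [q ^ (N - i)]: the same exponents in reverse order. *)
  rewrite !det_diag -big_split /= (reindex_inj rev_ord_inj) /=.
  apply: eq_bigr => i _; rewrite !mxE -expfzDr // exprnP; congr (_ ^ _).
  by have := ltn_ord i; lia.
rewrite mulrAC -!det_mulmx mul_diag_mx mul_mx_diag; congr (\det _).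
apply/matrixP => i j; rewrite !mxE mulrAC -expfzDr //; congr (q ^ _ * _).
by ring.
Qed.

(** * Cauchy products of coefficient sequences *)

Definition conv (F : fieldType) (f g : nat -> F) (n : nat) : F :=
  \sum_(i < n.+1) f i * g (n - i)%N.

Lemma conv0 (F : fieldType) (f g : nat -> F) : conv f g 0 = f 0%N * g 0%N.
Proof. by rewrite /conv big_ord_recl big_ord0 addr0. Qed.

Lemma convC (F : fieldType) (f g : nat -> F) : conv f g = conv g f.
Proof.
apply/funext => n; rewrite /conv (reindex_inj rev_ord_inj) /=.
by apply: eq_bigr => i _; rewrite subSS (subKn (leq_ord i)); apply: mulrC.
Qed.

(** As series, [f = (1 + a t) h], and this factor passes to the product with [g]. *)
Lemma conv_shiftl (F : fieldType) (a : F) (f h g : nat -> F) :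
  f 0%N = h 0%N -> (forall n, f n.+1 = h n.+1 + a * h n) ->
  forall n, conv f g n.+1 = conv h g n.+1 + a * conv h g n.
Proof.
move=> fh0 fhS n; rewrite /conv big_ord_recl [in RHS]big_ord_recl /= fh0.
rewrite -addrA mulr_sumr -big_split /=; congr (_ + _).
by apply: eq_bigr => i _; rewrite /bump /= !add1n subSS fhS; ring.
Qed.

Lemma conv_shiftr (F : fieldType) (a : F) (f h g : nat -> F) :
  f 0%N = h 0%N -> (forall n, f n.+1 = h n.+1 + a * h n) ->
  forall n, conv g f n.+1 = conv g h n.+1 + a * conv g h n.
Proof. by move=> fh0 fhS n; rewrite ![conv g _]convC; exact: conv_shiftl. Qed.

Lemma conv_scale (F : fieldType) (a : F) (f g : nat -> F) (n : nat) :
  conv (fun i => a ^+ i * f i) (fun i => a ^+ i * g i) n = a ^+ n * conv f g n.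
Proof.
rewrite /conv mulr_sumr; apply: eq_bigr => i _.
by rewrite mulrACA -exprD subnKC // leq_ord.
Qed.

(** * Effect of [q]-shifts on the generating series of [p] *)

Section GeneratingFunction.
Variables (R : realType) (q : R[i]).
Hypotheses (q0 : q != 0) (q_nroot : forall n, (0 < n)%N -> q ^+ n != 1).
Implicit Types y z w : R[i].

(** By Euler's expansions, for [|q| < 1], [qexp y] and [qexp2 w] list the coefficients of
    [1 / (y t; q)_oo] and [(- w t; q)_oo]. *)
Let qexp y (a : nat) : R[i] := y ^+ a / qpoch q a.
Let qexp2 w (c : nat) : R[i] := w ^+ c * q ^+ 'C(c, 2) / qpoch q c.

Lemma qpoch_neq0 n : qpoch q n != 0.
Proof.
by apply/prodf_neq0 => i _; rewrite subr_eq0 eq_sym q_nroot.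
Qed.

Lemma qpochS n : qpoch q n.+1 = qpoch q n * (1 - q * q ^+ n).
Proof. by rewrite /qpoch big_ord_recr /= exprS. Qed.

Let qexpS y n : qexp (q * y) n.+1 = qexp y n.+1 + - y * qexp y n.
Proof.
have := qpoch_neq0 n.+1; rewrite /qexp qpochS mulf_eq0 negb_or => /andP[n0 n1].
by rewrite exprMn !exprS; field; rewrite n0 n1.
Qed.

Let qexp2S w n : qexp2 w n.+1 = qexp2 (q * w) n.+1 + w * qexp2 (q * w) n.
Proof.
have := qpoch_neq0 n.+1; rewrite /qexp2 qpochS mulf_eq0 negb_or => /andP[n0 n1].
by rewrite binS bin1 exprD !exprMn !exprS; field; rewrite n0 n1.
Qed.

(** The prefactor is the rescaling [t -> (1 - q) t]; hence the twists of [p] carry a factor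
    [1 - q]. *)
Lemma p_natE n y z :
  p_nat q n y z = (1 - q) ^+ n * conv (qexp y) (conv (qexp z) (qexp2 1)) n.
Proof.
congr (_ * _); apply: eq_bigr => a _; rewrite mulr_sumr.
have lean : (n - a < n.+1)%N by rewrite ltnS leq_subr.
rewrite (@big_ord_widen_cond _ _ _ _ _ xpredT
  (fun b => qexp y a * (qexp z b * qexp2 1 (n - a - b)%N)) lean) /=.
have ltan := ltn_ord a.
apply: eq_big => [b|b _]; first by lia.
by rewrite /qexp /qexp2 expr1n mul1r !invfM; ring.
Qed.

Let P y z (k : int) : R[i] := p q k y z.

Let P_neg y z n : P y z (Negz n) = 0.
Proof. by []. Qed.

Lemma p_mulq_l y z : P (q * y) z = twist ((1 - q) * y) (P y z).
Proof.
apply/funext => -[[|n]|n]; last by rewrite twist_neg.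
  by rewrite /twist /P /= !p_natE !conv0 /qexp !expr0 mulr0 subr0.
rewrite /twist (_ : n.+1%:Z - 1 = n); last by lia.
rewrite /P /= !p_natE (conv_shiftl (a := - y) (h := qexp y)).
- by rewrite exprS; ring.
- by rewrite /qexp !expr0.
exact: qexpS.
Qed.

Lemma p_mulq_r y z : P y (q * z) = twist ((1 - q) * z) (P y z).
Proof.
apply/funext => -[[|n]|n]; last by rewrite twist_neg.
  by rewrite /twist /P /= !p_natE !conv0 /qexp !expr0 mulr0 subr0.
rewrite /twist (_ : n.+1%:Z - 1 = n); last by lia.
have e0 : qexp (q * z) 0 = qexp z 0 by rewrite /qexp !expr0.
rewrite /P /= !p_natE.
rewrite (conv_shiftr (a := - z) (h := conv (qexp z) (qexp2 1))).
- by rewrite exprS; ring.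
- by rewrite !conv0 e0.
exact: conv_shiftl e0 (qexpS z).
Qed.

(** Since [qexp2 1] is [1 + t] times [qexp2 q], all three factors take the rescaling [t -> q t],
    leaving [1 + t] over. *)
Lemma p_mulq_lr y z :
  P (q * y) (q * z) = twist (- (1 - q)) (fun k => q ^ k * P y z k).
Proof.
have qexp_scale x : qexp (q * x) = fun i => q ^+ i * qexp x i.
  by apply/funext => i; rewrite /qexp exprMn mulrA.
have qexp2_scale : qexp2 (q * 1) = fun i => q ^+ i * qexp2 1 i.
  by apply/funext => i; rewrite /qexp2 exprMn -!mulrA.
have scale n : conv (qexp (q * y)) (conv (qexp (q * z)) (qexp2 (q * 1))) n =
    q ^+ n * conv (qexp y) (conv (qexp z) (qexp2 1)) n.
  rewrite !qexp_scale qexp2_scale -conv_scale; congr (conv _ _ _).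
  by apply/funext => i; rewrite conv_scale.
have e0 : qexp2 1 0 = qexp2 (q * 1) 0 by rewrite /qexp2 !expr0.
apply/funext => -[[|n]|n]; last by rewrite twist_neg // => k; rewrite mulr0.
  rewrite /twist /P /= !p_natE !mulr0 subr0 -exprnP expr0 !mul1r.
  by rewrite !conv0 /qexp !expr0.
rewrite /twist (_ : n.+1%:Z - 1 = n); last by lia.
rewrite /P /= !p_natE -!exprnP.
rewrite (conv_shiftr (a := 1)
  (h := conv (qexp (q * z)) (qexp2 (q * 1)))).
- by rewrite !scale !exprS; ring.
- by rewrite !conv0 e0.
exact: conv_shiftr e0 (qexp2S 1).
Qed.

(** * Bilinear identities for [phi] *)

Let phiE N y z : phi_nat q N y z = tau N (P y z).
Proof. by []. Qed.

Let onemq_neq0 : 1 - q != 0.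
Proof. by rewrite subr_eq0 eq_sym -[q]expr1 q_nroot. Qed.

(** By evenness [twist (1 - q)] cancels the twist produced by shifting both variables, leaving only
    the weight of the rescaling. *)
Let rescale N y z :
  tau N (twist (1 - q) (P (q * y) (q * z))) =
  (\prod_(i < N) q ^+ i.+1) * phi_nat q N y z.
Proof.
rewrite p_mulq_lr tau_even ?tau_scale // => n.
by rewrite P_neg mulr0.
Qed.

(** The twist ratios [(1 - q) * y] and [(1 - q) * z] shift [y] and [z]; swapping their roles gives
    the companion identity. *)
Lemma phi_nat_bilinear_yz n y z :
  y * (phi_nat q n (q * y) (q * z) * phi_nat q n.+1 y z)
  + z * (phi_nat q n y z * phi_nat q n.+1 (q * y) (q * z)) =
  (y + z) * (phi_nat q n (q * y) z * phi_nat q n.+1 y (q * z)).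
Proof.
apply: (mulfI onemq_neq0); rewrite !phiE !p_mulq_r !p_mulq_l.
have := tau_twist_bilinear n ((1 - q) * y) ((1 - q) * z) (P_neg y z).
rewrite (twistC ((1 - q) * y) ((1 - q) * z)) => H.
by apply: etrans (etrans _ H) _; ring.
Qed.

Lemma phi_nat_bilinear_zy n y z :
  z * (phi_nat q n (q * y) (q * z) * phi_nat q n.+1 y z)
  + y * (phi_nat q n y z * phi_nat q n.+1 (q * y) (q * z)) =
  (y + z) * (phi_nat q n y (q * z) * phi_nat q n.+1 (q * y) z).
Proof.
apply: (mulfI onemq_neq0); rewrite !phiE !p_mulq_r !p_mulq_l.
have := tau_twist_bilinear n ((1 - q) * z) ((1 - q) * y) (P_neg y z).
by move=> H; apply: etrans (etrans _ H) _; ring.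
Qed.

Let scaling_weightS n :
  \prod_(i < n.+1) q ^+ i.+1 = (\prod_(i < n) q ^+ i.+1) * q ^+ n.+1.
Proof. by rewrite big_ord_recr. Qed.

Let scaling_weight_neq0 n : \prod_(i < n) q ^+ i.+1 != 0.
Proof. by apply/prodf_neq0 => i _; rewrite expf_neq0. Qed.

(** From the base point [(q y, q z)], the ratio [1 - q] leads back to [(y, z)] and
    [(1 - q) * (q * z)] shifts [z] once more. The power of [q] is the quotient of the weights for
    [n.+1] and [n]. *)
Lemma phi_nat_bilinear_1z n y z :
  phi_nat q n y (q * z) * phi_nat q n.+1 (q * y) (q * z)
  + q * z * q ^+ n.+1
    * (phi_nat q n (q * y) (q * z) * phi_nat q n.+1 y (q * z)) =
  (1 + q * z) * (phi_nat q n.+1 (q * y) (q * (q * z)) * phi_nat q n y z).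
Proof.
apply: (mulfI (mulf_neq0 onemq_neq0 (scaling_weight_neq0 n))).
have := tau_twist_bilinear n (1 - q) ((1 - q) * (q * z)) (P_neg (q * y) (q * z)).
rewrite -p_mulq_r !rescale -!phiE scaling_weightS.
move: (\prod_(i < n) _) (q ^+ n.+1) (phi_nat q n y _) (phi_nat q n y _)
  (phi_nat q n.+1 y _) (phi_nat q n (q * y) _) (phi_nat q n.+1 (q * y) _)
  (phi_nat q n.+1 (q * y) _) => d e A0 A1 A2 A3 A4 A5 H.
by apply: etrans (etrans _ H) _; ring.
Qed.

Lemma phi_nat_bilinear_z1 n y z :
  q * z * (phi_nat q n y (q * z) * phi_nat q n.+1 (q * y) (q * z))
  + q ^+ n.+1 * (phi_nat q n (q * y) (q * z) * phi_nat q n.+1 y (q * z)) =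
  q ^+ n.+1 * (1 + q * z)
    * (phi_nat q n (q * y) (q * (q * z)) * phi_nat q n.+1 y z).
Proof.
apply: (mulfI (mulf_neq0 onemq_neq0 (scaling_weight_neq0 n))).
have := tau_twist_bilinear n ((1 - q) * (q * z)) (1 - q) (P_neg (q * y) (q * z)).
rewrite (twistC _ (1 - q)) -p_mulq_r !rescale -!phiE scaling_weightS.
move: (\prod_(i < n) _) (q ^+ n.+1) (phi_nat q n y _)
  (phi_nat q n.+1 y _) (phi_nat q n.+1 y _) (phi_nat q n (q * y) _)
  (phi_nat q n (q * y) _) (phi_nat q n.+1 (q * y) _) => d e A0 A1 A2 A3 A4 A5 H.
by apply: etrans (etrans _ H) _; ring.
Qed.

(* For negative [N] the reflection [phi_N = +- phi_(-N-1)] exchanges the two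
   identities of each pair. *)
Lemma phi_bilinear_yz (N : int) y z :
  y * (phi q (N - 1) (q * y) (q * z) * phi q N y z)
  + z * (phi q (N - 1) y z * phi q N (q * y) (q * z)) =
  (y + z) * (phi q (N - 1) (q * y) z * phi q N y (q * z)).
Proof.
case: N => [[|n]|n].
(* At [N = 0], [phi] at [- 1] has sign 1, so every [phi] is an empty determinant. *)
- by rewrite /= /phi_nat !det_mx00; ring.
- by rewrite (_ : n.+1%:Z - 1 = n); [exact: phi_nat_bilinear_yz | lia].
rewrite (_ : Negz n - 1 = Negz n.+1); last by lia.
rewrite /phi; set s := (-1) ^+ 'C(n.+2, 2); set t := (-1) ^+ 'C(n.+1, 2).
have := congr1 ( *%R (s * t)) (phi_nat_bilinear_zy n y z).
move: (phi_nat q n.+1 _ _) (phi_nat q n.+1 _ _) (phi_nat q n.+1 _ _)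
  (phi_nat q n _ _) (phi_nat q n _ _) (phi_nat q n _ _) => A1 A2 A3 A4 A5 A6 H.
by apply: etrans (etrans _ H) _; ring.
Qed.

Lemma phi_bilinear_zy (N : int) y z :
  z * (phi q (N - 1) (q * y) (q * z) * phi q N y z)
  + y * (phi q (N - 1) y z * phi q N (q * y) (q * z)) =
  (y + z) * (phi q (N - 1) y (q * z) * phi q N (q * y) z).
Proof.
case: N => [[|n]|n].
- by rewrite /= /phi_nat !det_mx00; ring.
- by rewrite (_ : n.+1%:Z - 1 = n); [exact: phi_nat_bilinear_zy | lia].
rewrite (_ : Negz n - 1 = Negz n.+1); last by lia.
rewrite /phi; set s := (-1) ^+ 'C(n.+2, 2); set t := (-1) ^+ 'C(n.+1, 2).
have := congr1 ( *%R (s * t)) (phi_nat_bilinear_yz n y z).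
move: (phi_nat q n.+1 _ _) (phi_nat q n.+1 _ _) (phi_nat q n.+1 _ _)
  (phi_nat q n _ _) (phi_nat q n _ _) (phi_nat q n _ _) => A1 A2 A3 A4 A5 A6 H.
by apply: etrans (etrans _ H) _; ring.
Qed.

Lemma phi_bilinear_1z (N : int) y z :
  phi q (N - 1) y (q * z) * phi q N (q * y) (q * z)
  + q * z * q ^ N * (phi q (N - 1) (q * y) (q * z) * phi q N y (q * z)) =
  (1 + q * z) * (phi q N (q * y) (q * (q * z)) * phi q (N - 1) y z).
Proof.
case: N => [[|n]|n].
- by rewrite expr0z /= /phi_nat !det_mx00; ring.
- by rewrite (_ : n.+1%:Z - 1 = n); [exact: phi_nat_bilinear_1z | lia].
rewrite (_ : Negz n - 1 = Negz n.+1); last by lia.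
rewrite -[q ^ Negz n]/((q ^+ n.+1)^-1).
rewrite /phi; set s := (-1) ^+ 'C(n.+2, 2); set t := (-1) ^+ 'C(n.+1, 2).
have e0 : q ^+ n.+1 != 0 by rewrite expf_neq0.
have := phi_nat_bilinear_z1 n y z.
move: (q ^+ n.+1) e0 (phi_nat q n.+1 y _) (phi_nat q n.+1 y _)
  (phi_nat q n.+1 (q * y) _) (phi_nat q n y _) (phi_nat q n (q * y) _)
  (phi_nat q n (q * y) _) => e e0 A1 A2 A3 A4 A5 A6 H.
(* Here [q ^ N = e^-1], so besides the signs [s * t] the companion identity is divided by [e]. *)
apply: etrans (etrans _ (congr1 ( *%R (s * t / e)) H)) _; first by field.
by field.
Qed.

Lemma phi_bilinear_z1 (N : int) y z :
  q * z * (phi q (N - 1) y (q * z) * phi q N (q * y) (q * z))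
  + q ^ N * (phi q (N - 1) (q * y) (q * z) * phi q N y (q * z)) =
  q ^ N * (1 + q * z)
    * (phi q (N - 1) (q * y) (q * (q * z)) * phi q N y z).
Proof.
case: N => [[|n]|n].
- by rewrite expr0z /= /phi_nat !det_mx00; ring.
- by rewrite (_ : n.+1%:Z - 1 = n); [exact: phi_nat_bilinear_z1 | lia].
rewrite (_ : Negz n - 1 = Negz n.+1); last by lia.
rewrite -[q ^ Negz n]/((q ^+ n.+1)^-1).
rewrite /phi; set s := (-1) ^+ 'C(n.+2, 2); set t := (-1) ^+ 'C(n.+1, 2).
have e0 : q ^+ n.+1 != 0 by rewrite expf_neq0.
have := phi_nat_bilinear_1z n y z.
move: (q ^+ n.+1) e0 (phi_nat q n.+1 y _) (phi_nat q n.+1 (q * y) _)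
  (phi_nat q n.+1 (q * y) _) (phi_nat q n y _) (phi_nat q n y _)
  (phi_nat q n (q * y) _) => e e0 A1 A2 A3 A4 A5 A6 H.
apply: etrans (etrans _ (congr1 ( *%R (s * t / e)) H)) _; first by field.
by field.
Qed.

End GeneratingFunction.

(** * The [q]-Painleve III equation *)

Unset Implicit Arguments.

Theorem theorem4 (R : realType) (q : R[i]) (N : int) (y z : R[i]) :
  q != 0 ->
  (forall n : nat, (0 < n)%N -> q ^+ n != 1) ->
  (* all denominators occurring in f0(z), f1(z), f1(qz), f0(z/q) are nonzero *)
  phi q (N - 1) (y / q) z != 0 -> phi q N y z != 0 ->
  phi q (N - 1) y z != 0 -> phi q N (y / q) (z / q) != 0 ->
  phi q (N - 1) y (q * z) != 0 -> phi q N (y / q) z != 0 ->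
  phi q (N - 1) (y / q) (z / q) != 0 -> phi q N y (z / q) != 0 ->
  z != 0 ->
  f0 q N y z * f1 q N y z != 0 ->
  z + f0 q N y z != 0 ->
  1 + (y / z) * f1 q N y z != 0 ->
  let c := q ^ N in
  f1 q N y (q * z) =
    c ^+ 2 / (f0 q N y z * f1 q N y z)
    * ((1 + z * f0 q N y z) / (z + f0 q N y z))
  /\
  f0 q N y (z / q) =
    c ^+ 2 / (f0 q N y z * f1 q N y z)
    * ((y / z + f1 q N y z) / (1 + (y / z) * f1 q N y z)).
Proof.
move=> q0 q_nroot; rewrite /f0 /f1.
(* With [Y = y / q] and [Z = z / q] every argument is a forward shift of [(Y, Z)], as in the
   bilinear identities. *)
have -> : y = q * (y / q) by field.
have -> : z = q * (z / q) by field.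
have qK x : q * x / q = x by field.
rewrite !qK; move: (y / q) (z / q) => Y Z.
have := phi_bilinear_yz q0 q_nroot N Y Z.
have := phi_bilinear_zy q0 q_nroot N Y Z.
have := phi_bilinear_1z q0 q_nroot N Y Z.
have := phi_bilinear_z1 q0 q_nroot N Y Z.
have := expfz_neq0 N q0; move: (q ^ N) => c.
move: (phi q (N - 1) (q * Y) (q * (q * Z))) (phi q N (q * Y) (q * (q * Z)))
  (phi q (N - 1) (q * Y) (q * Z)) (phi q N (q * Y) (q * Z))
  (phi q (N - 1) (q * Y) Z) (phi q N (q * Y) Z)
  (phi q (N - 1) Y (q * Z)) (phi q N Y (q * Z))
  (phi q (N - 1) Y Z) (phi q N Y Z) => l k a e m o d b g h.
move=> c0 H2 H1 H4 H3 d0 e0 a0 h0 l0 b0 g0 o0 qZ0 _.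
have Z0 : Z != 0 by apply: contraNneq qZ0 => ->; rewrite mulr0.
(* The four identities factor [z + f0], [1 + z f0], [y/z + f1] and [1 + (y/z) f1] in turn; in each
   quotient [1 + q Z] or [Y + Z] cancels, leaving monomials in values of [phi]. *)
have -> : q * Z + c * (a * b) / (d * e) =
    c * (1 + q * Z) * (l * h) / (d * e).
  by rewrite -H2; field; rewrite d0 e0.
have -> : 1 + q * Z * (c * (a * b) / (d * e)) = (1 + q * Z) * (k * g) / (d * e).
  by rewrite -H1; field; rewrite d0 e0.
have -> : q * Y / (q * Z) + g * e / (a * h) = (Y + Z) * (m * b) / (Z * (a * h)).
  by rewrite -H3; field; rewrite a0 h0 Z0 q0.
have -> : 1 + q * Y / (q * Z) * (g * e / (a * h)) =
    (Y + Z) * (d * o) / (Z * (a * h)).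
  by rewrite -H4; field; rewrite a0 h0 Z0 q0.
(* The nonzero denominators [z + f0] and [1 + (y/z) f1], now factored, show that [1 + q Z] and
   [Y + Z] are nonzero. *)
rewrite !mulf_eq0 !negb_or => /andP[/andP[/andP[_ z1] _] _].
move=> /andP[/andP[yz0 _] _] /=.
by split; field; rewrite ?z1 ?yz0 ?c0 ?d0 ?e0 ?a0 ?h0 ?l0 ?b0 ?g0 ?o0 ?Z0.
Qed.
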